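(* Let $d$ be a positive integer with $d\equiv 0\pmod 4$, put $d'=d/4$, let $k$ be a rational and $\varepsilon$ a positive real such that $$2\le k<2+\frac{1}{2d'-1}\qquad\text{and}\qquad \varepsilon\sum_{j=0}^{d'-2}(k-1)^{2j+2}+\varepsilon\cdot\frac{k-1+\varepsilon}{k+\varepsilon}\ \ge\ \frac{1}{k+\varepsilon}.$$ If $G$ is a fractionally $k$-colorable graph and $W\subseteq V(G)$ is a set of vertices at pairwise distance at least $d$, then every fractional $(k+\varepsilon)$-precoloring of $W$ extends to a fractional $(k+\varepsilon)$-coloring of $G$.
   Context: A fractional $m$-coloring of a graph (real $m>0$) assigns to each vertex a measurable subset of $[0,m)$ of Lebesgue measure one so that adjacent vertices receive disjoint sets; a graph is fractionally $k$-colorable if it has a fractional $k$-coloring. A fractional $m$-precoloring of a vertex set $W$ assigns measurable subsets of $[0,m)$ of measure one to the vertices of $W$; it extends if some fractional $m$-coloring of the whole graph agrees with it on $W$. Graphs are finite. *)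

(* Defs.v *)
From Stdlib Require Import Reals QArith.
From mathcomp Require Import all_boot.
Set Implicit Arguments.
Unset Strict Implicit.
Unset Printing Implicit Defensive.

Open Scope R_scope.

Definition interval_cover (A : R -> Prop) (s : R) : Prop :=
  exists a b : nat -> R,
    (forall n, a n <= b n) /\
    (forall x, A x -> exists n, a n <= x < b n) /\
    infinite_sum (fun n => b n - a n) s.

Definition lebesgue_outer (A : R -> Prop) (r : R) : Prop :=
  (forall s, interval_cover A s -> r <= s) /\
  (forall r', (forall s, interval_cover A s -> r' <= s) -> r' <= r).

(* Caratheodory measurability (test sets of infinite outer measure satisfy
   the criterion automatically, so only finite ones are tested). *)
Definition lebesgue_measurable (A : R -> Prop) : Prop :=
  forall (T : R -> Prop) (r : R), lebesgue_outer T r ->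
    exists r1 r2 : R,
      lebesgue_outer (fun x => T x /\ A x) r1 /\
      lebesgue_outer (fun x => T x /\ ~ A x) r2 /\
      r1 + r2 = r.

Definition unit_color_set (m : R) (A : R -> Prop) : Prop :=
  (forall x, A x -> 0 <= x < m) /\ lebesgue_measurable A /\ lebesgue_outer A 1.

Definition simple_graph (V : finType) (e : rel V) : Prop :=
  symmetric e /\ irreflexive e.

Definition fractional_coloring (V : finType) (e : rel V) (m : R)
    (c : V -> R -> Prop) : Prop :=
  (forall v, unit_color_set m (c v)) /\
  (forall u v, e u v -> forall x, c u x -> c v x -> False).

Definition fractionally_colorable (V : finType) (e : rel V) (m : R) : Prop :=
  exists c, fractional_coloring e m c.

Definition fractional_precoloring (V : finType) (W : {set V}) (m : R)
    (phi : V -> R -> Prop) : Prop :=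
  forall w, w \in W -> unit_color_set m (phi w).

Definition precoloring_extends (V : finType) (e : rel V) (W : {set V}) (m : R)
    (phi : V -> R -> Prop) : Prop :=
  exists c, fractional_coloring e m c /\
    (forall w, w \in W -> forall x, c w x <-> phi w x).

(* dist(u,v) >= d : every walk from u to v has at least d edges
   (vacuous if u and v lie in different components: distance infinity). *)
Definition dist_ge (V : finType) (e : rel V) (u v : V) (d : nat) : Prop :=
  forall p : seq V, path e u p -> last u p = v -> (d <= size p)%N.

Definition pairwise_far (V : finType) (e : rel V) (W : {set V}) (d : nat) : Prop :=
  forall u v, u \in W -> v \in W -> u <> v -> dist_ge e u v d.

Fixpoint rsum (n : nat) (f : nat -> R) : R :=
  match n with
  | O => 0
  | S n' => rsum n' f + f n'
  end.

(* Main.v *)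
Require Import Defs.
From Stdlib Require Import Reals QArith Lra ClassicalEpsilon.
From mathcomp Require Import all_boot.
From mathcomp Require Import boolp classical_sets.
Set Implicit Arguments.
Unset Strict Implicit.
Unset Printing Implicit Defensive.
Open Scope R_scope.
Local Open Scope classical_set_scope.

(* Put m = k + eps. A k-coloring is copied into a subset C of [0,m) of measure
   k, mixed so evenly that every color class and every precolored set phi w
   meet in measure 1/m; E = [0,m) \ C is spare. Since k < 2 + 1/(2d'-1), the
   graph has no odd closed walk of length at most 4d'-1, so within distance
   2d'-1 of a precolored vertex w the spheres around w are independent. On
   these spheres the coloring is bent towards phi w at w: going inwards from
   distance 2d', vertices at odd levels give up more and more colors of phi w,
   and vertices at even levels more and more colors outside phi w. If a level
   gives up measure g of every color class, then k g in total is available to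
   the next inner level, which gains (k-1) g; odd levels gain a further eps
   from E, except that level 1 can use only E \ phi w, of measure
   eps (m-1)/m. The hypothesis says that the gain accumulated at level 1
   reaches the measure 1/m of phi w in a color class. *)

(** * Lebesgue outer measure *)

Lemma nonneg_series_cv (u : nat -> R) (b : R) :
  (forall n, 0 <= u n) -> (forall n, sum_f_R0 u n <= b) ->
  exists2 s, infinite_sum u s & s <= b.
Proof.
move=> u0 ub.
have grow : Un_growing (sum_f_R0 u) by move=> n /=; have := u0 n.+1; lra.
have [s us] : {s | Un_cv (sum_f_R0 u) s}.
  by apply: growing_cv => //; exists b => _ [n ->].
exists s => //; apply: (@Rle_cv_lim _ (fun=> b) _ _ ub us) => // e e0.
by exists 0%nat => n _; rewrite /Rdist Rminus_diag Rabs_R0.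
Qed.

Lemma infinite_sum_ge0 (u : nat -> R) (s : R) :
  (forall n, 0 <= u n) -> infinite_sum u s -> 0 <= s.
Proof. by move=> u0 us; have /= := sum_incr u 0 s us u0; have := u0 0%nat; lra. Qed.

Lemma interval_cover_ge0 (A : set R) s : interval_cover A s -> 0 <= s.
Proof.
move=> [a [b [ab [_ sab]]]]; apply: infinite_sum_ge0 sab => n.
by have := ab n; lra.
Qed.

(** Outer measure is given as a relation with real values; this marks the sets to which it assigns a
    value at all. *)
Definition finite_outer (A : set R) := exists s, interval_cover A s.

(** The infimum of the cover lengths is the supremum of their lower bounds. If there is no cover,
    every real is vacuously a lower bound and none is greatest. *)
Lemma finite_outerP (A : set R) : finite_outer A <-> exists r, lebesgue_outer A r.
Proof.
split=> [[s As]|[r [_ rA]]].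
  have [] := completeness (fun y => forall s, interval_cover A s -> y <= s).
  - by exists s => y; apply.
  - by exists 0 => s'; apply: interval_cover_ge0.
  - move=> r [ub lub]; exists r; split; last by move=> r' r'A; apply: ub.
    by move=> s' As'; apply: lub => y; apply.
apply: contrapT => /forallNP nA.
have : r + 1 <= r by apply: rA => s /nA.
lra.
Qed.

Lemma lebesgue_outer_unique (A : set R) r r' :
  lebesgue_outer A r -> lebesgue_outer A r' -> r = r'.
Proof. by move=> [h1 h2] [h3 h4]; apply: Rle_antisym; [apply: h4|apply: h2]. Qed.

(** Made total by choice; the value is arbitrary where [finite_outer] fails. *)
Definition mu (A : set R) : R := epsilon (inhabits 0) (lebesgue_outer A).

Lemma muP (A : set R) : finite_outer A -> lebesgue_outer A (mu A).
Proof. by move=> /finite_outerP; apply: epsilon_spec. Qed.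

Lemma mu_eq (A : set R) r : lebesgue_outer A r -> mu A = r.
Proof.
move=> Ar; apply: (lebesgue_outer_unique _ Ar); apply: muP.
by apply/finite_outerP; exists r.
Qed.

Lemma interval_cover_le (A B : set R) s :
  A `<=` B -> interval_cover B s -> interval_cover A s.
Proof. by move=> AB [a [b [ab [cB sab]]]]; exists a, b; split=> //; split=> // x /AB/cB. Qed.

Lemma finite_outer_le (A B : set R) : A `<=` B -> finite_outer B -> finite_outer A.
Proof. by move=> AB [s Bs]; exists s; apply: interval_cover_le Bs. Qed.

Lemma mu_le (A B : set R) : A `<=` B -> finite_outer B -> mu A <= mu B.
Proof.
move=> AB fB; have [_] := muP fB; apply => s Bs.
by have [+ _] := muP (finite_outer_le AB fB); apply; apply: interval_cover_le Bs.
Qed.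

Lemma mu_ge0 (A : set R) : finite_outer A -> 0 <= mu A.
Proof. by move=> /muP[_]; apply => s /interval_cover_ge0. Qed.

Lemma mu_le_cover (A : set R) s : interval_cover A s -> mu A <= s.
Proof. by move=> As; have [|+ _] := @muP A; [exists s|apply]. Qed.

Lemma mu_approx (A : set R) e : finite_outer A -> 0 < e ->
  exists2 s, interval_cover A s & s < mu A + e.
Proof.
move=> fA e0; apply: contrapT => /forall2NP H.
have [_ rA] := muP fA.
have : mu A + e <= mu A by apply: rA => s As; case: (H s) => //; lra.
lra.
Qed.

Lemma interleave_sum (u v : nat -> R) n :
  sum_f_R0 (fun i => if odd i then v i./2 else u i./2) n.*2.+1 =
  sum_f_R0 u n + sum_f_R0 v n.
Proof.
elim: n => [//|n IH]; rewrite doubleS 2!tech5 IH (tech5 u) (tech5 v) /=.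
by rewrite odd_double /= doubleK uphalf_double; lra.
Qed.

Lemma sum_f_R0_le (u : nat -> R) m n :
  (forall n, 0 <= u n) -> (m <= n)%N -> sum_f_R0 u m <= sum_f_R0 u n.
Proof.
move=> u0 /subnK <-; elim: (n - m)%N => [|p IH]; first by rewrite add0n; lra.
by rewrite addSn tech5; have := u0 (p + m).+1; lra.
Qed.

(** The two covers are interleaved by parity of the index. Partial sums ending at an odd index split
    into one partial sum of each cover, which bounds all of them. *)
Lemma interval_coverU (A B : set R) s t :
  interval_cover A s -> interval_cover B t ->
  exists2 w, interval_cover (A `|` B) w & w <= s + t.
Proof.
move=> [a [b [ab [cA sA]]]] [a' [b' [ab' [cB sB]]]].
pose l i := if odd i then a' i./2 else a i./2.
pose r i := if odd i then b' i./2 else b i./2.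
pose u i := b i - a i; pose v i := b' i - a' i.
have u0 i : 0 <= u i by have := ab i; rewrite /u; lra.
have v0 i : 0 <= v i by have := ab' i; rewrite /v; lra.
have lrE i : r i - l i = if odd i then v i./2 else u i./2 by rewrite /r /l; case: ifP.
have lr0 i : 0 <= r i - l i by rewrite lrE; case: ifP.
have [||w sw wle] := @nonneg_series_cv (fun i => r i - l i) (s + t).
- exact: lr0.
- move=> n; apply: Rle_trans (sum_f_R0_le (n := n.*2.+1) lr0 _) _.
    by rewrite -addnn -addnS leq_addr.
  have -> : sum_f_R0 (fun i => r i - l i) n.*2.+1 = sum_f_R0 u n + sum_f_R0 v n.
    by rewrite -interleave_sum; congr (sum_f_R0 _ _); apply/funext => i; apply: lrE.
  have := sum_incr u n s sA u0; have := sum_incr v n t sB v0; lra.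
exists w => //; exists l, r; split; first by move=> i; have := lr0 i; lra.
split=> // x [/cA|/cB] [n ?].
  by exists n.*2; rewrite /l /r odd_double doubleK.
by exists n.*2.+1; rewrite /l /r /= odd_double /= uphalf_double.
Qed.

Lemma finite_outerU (A B : set R) :
  finite_outer A -> finite_outer B -> finite_outer (A `|` B).
Proof. by move=> [s As] [t Bt]; have [w] := interval_coverU As Bt; exists w. Qed.

Lemma mu_subadd (A B : set R) : finite_outer A -> finite_outer B ->
  mu (A `|` B) <= mu A + mu B.
Proof.
move=> fA fB; apply: le_epsilon => e e0.
have [s As sle] := @mu_approx A (e / 2) fA ltac:(lra).
have [t Bt tle] := @mu_approx B (e / 2) fB ltac:(lra).
have [w ABw wle] := interval_coverU As Bt.
by have := mu_le_cover ABw; lra.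
Qed.

(** * Caratheodory measurability *)

(** The opposite inequality is subadditivity, so only this one has to be checked. *)
Lemma measurable_criterion (A : set R) :
  lebesgue_measurable A <->
  forall X, finite_outer X -> mu (X `&` A) + mu (X `\` A) <= mu X.
Proof.
split=> [mA X fX|H T r Tr].
  have [r1 [r2 [h1 [h2 h3]]]] := mA _ _ (muP fX).
  by rewrite (mu_eq h1) (mu_eq h2); lra.
have fT : finite_outer T by apply/finite_outerP; exists r.
have f1 : finite_outer (T `&` A) by apply: finite_outer_le fT => x [].
have f2 : finite_outer (T `\` A) by apply: finite_outer_le fT => x [].
exists (mu (T `&` A)), (mu (T `\` A)); split; first exact: muP.
split; first exact: muP.
have := H T fT; have := mu_subadd f1 f2.
have -> : (T `&` A) `|` (T `\` A) = T by exact: setUIDK.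
by rewrite (mu_eq Tr); lra.
Qed.

Lemma mu_split (X A : set R) : lebesgue_measurable A -> finite_outer X ->
  mu X = mu (X `&` A) + mu (X `\` A).
Proof.
move=> mA fX.
have [r1 [r2 [h1 [h2 h3]]]] := mA _ _ (muP fX).
by rewrite (mu_eq h1) (mu_eq h2); lra.
Qed.

Lemma lebesgue_measurableC (A : set R) :
  lebesgue_measurable A -> lebesgue_measurable (~` A).
Proof.
move=> /measurable_criterion mA; apply/measurable_criterion => X fX.
have -> : X `\` ~` A = X `&` A by rewrite setDE setCK.
by rewrite -setDE; have := mA X fX; lra.
Qed.

(** Cut [X] by [A], then [X ∩ A] by [B]. The two pieces outside [A ∩ B] are merged by
    subadditivity. *)
Lemma lebesgue_measurableI (A B : set R) : lebesgue_measurable A ->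
  lebesgue_measurable B -> lebesgue_measurable (A `&` B).
Proof.
move=> mA mB; apply/measurable_criterion => X fX.
have fXA : finite_outer (X `&` A) by apply: finite_outer_le fX => x [].
have -> : X `\` (A `&` B) = ((X `&` A) `\` B) `|` (X `\` A).
  by apply/seteqP; split=> x /=; have := EM (A x); rewrite /setI /setU /setD /mkset/=; tauto.
rewrite [mu X](mu_split mA) // [mu (X `&` A)](mu_split mB) // setIA.
have := @mu_subadd ((X `&` A) `\` B) (X `\` A)
  (finite_outer_le (@subDsetl _ _ _) fXA) (finite_outer_le (@subDsetl _ _ _) fX).
lra.
Qed.

(* Innermost tests first, so that no case split hides behind another one. *)
Ltac case_Rle := repeat match goal with |- context [Rle_dec ?x ?y] =>
  lazymatch x with context [Rle_dec] => fail | _ =>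
    lazymatch y with context [Rle_dec] => fail | _ => destruct (Rle_dec x y) end
  end end.

(** Each interval of a nearly optimal cover is cut at [t]. The left pieces cover the part of [X]
    below [t], the right pieces cover the rest, and the total length is unchanged. *)
Lemma lebesgue_measurable_lt (t : R) : lebesgue_measurable [set x | x < t].
Proof.
apply/measurable_criterion => X fX; apply: le_epsilon => e e0.
have [s [a [b [ab [cX sX]]]] slt] := mu_approx fX e0.
(* The point [t] pushed into the n-th interval; one piece is empty when [t] lies outside. *)
pose c n := Rmax (a n) (Rmin (b n) t).
have ac n : a n <= c n <= b n.
  by have := ab n; rewrite /c /Rmax /Rmin; case_Rle; lra.
have uE n : b n - a n = (c n - a n) + (b n - c n) by lra.
have ge0 : (forall n, 0 <= c n - a n) /\ (forall n, 0 <= b n - c n) /\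
           (forall n, 0 <= b n - a n).
  by split; [|split] => n; have := ac n; lra.
case: ge0 => l0 [r0 u0].
have partial n : sum_f_R0 (fun i => c i - a i) n + sum_f_R0 (fun i => b i - c i) n <= s.
  rewrite -sum_plus; apply: Rle_trans (sum_incr _ n s sX u0).
  by right; congr (sum_f_R0 _ _); apply/funext => i; rewrite uE.
have [|s1 S1 _] := nonneg_series_cv (b := s) l0.
  by move=> n; have := partial n; have := cond_pos_sum (fun i => b i - c i) n r0; lra.
have [|s2 S2 _] := nonneg_series_cv (b := s) r0.
  by move=> n; have := partial n; have := cond_pos_sum (fun i => c i - a i) n l0; lra.
have S12 : s1 + s2 = s.
  apply: UL_sequence sX; have := CV_plus _ _ _ _ S1 S2; congr Un_cv.
  apply/funext => n; rewrite -sum_plus; congr (sum_f_R0 _ _).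
  by apply/funext => i; rewrite uE.
have m1 : mu (X `&` [set x | x < t]) <= s1.
  apply: mu_le_cover; exists a, c; split=> [n|]; first by have := ac n; lra.
  split=> // x [/cX[n ?]] /= xt; exists n; move: xt.
  by rewrite /c /Rmax /Rmin; case_Rle; lra.
have m2 : mu (X `\` [set x | x < t]) <= s2.
  apply: mu_le_cover; exists c, b; split=> [n|]; first by have := ac n; lra.
  split=> // x [/cX[n ?]] /= xt; exists n; move: xt.
  by rewrite /c /Rmax /Rmin; case_Rle; lra.
lra.
Qed.

(** * Measure of half-open intervals *)

Definition Ico (a b : R) : set R := [set x | a <= x < b].

Lemma interval_cover_Ico a b : a <= b -> interval_cover (Ico a b) (b - a).
Proof.
move=> ab; exists (fun=> a), (fun n => if n is 0%nat then b else a).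
split=> [[|n]|]; [by []|by right|split].
  by move=> x xab; exists 0%nat.
move=> e e0; exists 0%nat => n _.
rewrite (_ : sum_f_R0 _ n = b - a) ?Rdist_eq //.
by elim: n => [//|n IH]; rewrite tech5 IH; lra.
Qed.

Lemma finite_outer_Ico a b : a <= b -> finite_outer (Ico a b).
Proof. by move=> /interval_cover_Ico; exists (b - a). Qed.

(* The sup [t] of the points up to which finitely many of the intervals
   have almost full length is itself such a point, and an interval
   containing [t] moves it to the right. *)
Lemma interval_cover_Ico_ge x s : 0 <= x -> interval_cover (Ico 0 x) s -> x <= s.
Proof.
move=> x0 [a [b [ab [cX sX]]]].
(* For t ≥ 0, [len t n] is the length of the part of the n-th interval inside [0,t). *)
pose clip t y := Rmax 0 (Rmin y t).
pose len t n := clip t (b n) - clip t (a n).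
pose good t := 0 <= t <= x /\
  forall e, 0 < e -> exists n, t - e <= sum_f_R0 (len t) n.
have len0 t n : 0 <= len t n.
  have := ab n; rewrite /len /clip /Rmax /Rmin.
  by case_Rle; lra.
have len_le t t' n : t <= t' -> len t n <= len t' n.
  move=> tt'; have := ab n; rewrite /len /clip /Rmax /Rmin.
  by case_Rle; lra.
have len_b t n : len t n <= b n - a n.
  have := ab n; rewrite /len /clip /Rmax /Rmin.
  by case_Rle; lra.
have good0 : good 0.
  split=> [|e e0]; first lra.
  by exists 0%nat => /=; have := len0 0 0%nat; lra.
have [||t [tub tlub]] := completeness good.
- by exists x => t [[]].
- by exists 0.
have t0x : 0 <= t <= x.
  by split; [exact: tub|apply: tlub => y []; lra].
have goodt : good t.
  split=> // e e0.
  have [t' [t'x gt']] : exists2 t', good t' & t - e / 2 < t'.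
    apply: contrapT => /forall2NP H.
    have : t <= t - e / 2 by apply: tlub => y gy; case: (H y) => // h; lra.
    lra.
  move=> lt'; have [n hn] := gt' (e / 2) ltac:(lra); exists n.
  have : sum_f_R0 (len t') n <= sum_f_R0 (len t) n.
    by apply: sum_Rle => i _; apply: len_le; apply: tub; split.
  lra.
have [tx|tx] : t < x \/ t = x by lra.
  have [n ant] := cX t (conj (proj1 t0x) tx).
  pose t' := Rmin (b n) x.
  have tt' : t < t' <= b n /\ t' <= x by rewrite /t' /Rmin; case_Rle; lra.
  have : t' <= t; last lra.
  apply: tub; split=> [|e e0]; first lra.
  have [N hN] := goodt.2 e e0; exists (maxn N n).
  have hn : len t n + (t' - t) <= len t' n.
    rewrite /len /clip /Rmax /Rmin.
    by case_Rle; lra.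
  (* From [t] to [t'] the n-th interval gains at least [t' - t] and no other interval loses; the sum
     must run far enough to include both [N] and [n]. *)
  have : sum_f_R0 (len t) (maxn N n) + (t' - t) <= sum_f_R0 (len t') (maxn N n).
    have : (n <= maxn N n)%N by rewrite leq_maxr.
    elim: (maxn N n) => [|p IH]; first by
      rewrite leqn0 => /eqP n0; move: hn; rewrite n0 /=; lra.
    rewrite leq_eqVlt !tech5 => /orP[/eqP n0|/IH h].
      have : sum_f_R0 (len t) p <= sum_f_R0 (len t') p.
        by apply: sum_Rle => i _; apply: len_le; lra.
      move: hn; rewrite n0; lra.
    by have := @len_le t t' p.+1 ltac:(lra); lra.
  have := sum_f_R0_le (len0 t) (leq_maxl N n); lra.
apply: le_epsilon => e e0; have [n hn] := goodt.2 e e0.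
have : sum_f_R0 (len t) n <= sum_f_R0 (fun i => b i - a i) n.
  by apply: sum_Rle => i _.
have := @sum_incr _ n s sX (fun i => ltac:(have := ab i; lra)); lra.
Qed.

Lemma mu_Ico x : 0 <= x -> mu (Ico 0 x) = x.
Proof.
move=> x0; apply: mu_eq; split=> [s|r H]; first exact: interval_cover_Ico_ge.
by rewrite -[X in _ <= X]Rminus_0_r; apply: H; apply: interval_cover_Ico.
Qed.

(** * Measurable sets of colors *)

Definition color_set (m : R) (A : set R) : Prop :=
  A `<=` Ico 0 m /\ lebesgue_measurable A.

Lemma color_set_finite m A : color_set m A -> finite_outer A.
Proof.
move=> [Am _]; have [m0|m0] := Rle_lt_dec 0 m.
  by apply: finite_outer_le Am _; apply: finite_outer_Ico.
apply: (finite_outer_le (B := Ico 0 0)); last by apply: finite_outer_Ico; right.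
by move=> x /Am; rewrite /Ico /=; lra.
Qed.
#[local] Hint Resolve color_set_finite : core.

Lemma color_setI m A B : color_set m A -> color_set m B -> color_set m (A `&` B).
Proof.
by move=> [Am mA] [Bm mB]; split=> [x [/Am] //|]; apply: lebesgue_measurableI.
Qed.

Lemma color_setD m A B : color_set m A -> color_set m B -> color_set m (A `\` B).
Proof.
move=> [Am mA] [Bm mB]; split=> [x [/Am] //|].
by rewrite setDE; apply: lebesgue_measurableI => //; apply: lebesgue_measurableC.
Qed.

Lemma color_setU m A B : color_set m A -> color_set m B -> color_set m (A `|` B).
Proof.
move=> [Am mA] [Bm mB]; split=> [x [/Am|/Bm]//|].
by rewrite -[A `|` B]setCK setCU; apply: lebesgue_measurableC;
  apply: lebesgue_measurableI; apply: lebesgue_measurableC.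
Qed.

Lemma color_set_lt m A t : color_set m A -> color_set m (A `&` [set x | x < t]).
Proof.
move=> [Am mA]; split=> [x [/Am] //|].
by apply: lebesgue_measurableI => //; apply: lebesgue_measurable_lt.
Qed.

Lemma color_set_Ico m : color_set m (Ico 0 m).
Proof.
split=> //; have -> : Ico 0 m = [set x | x < m] `&` ~` [set x | x < 0].
  by apply/seteqP; split=> x; rewrite /Ico /setI /setC /mkset /=; lra.
apply: lebesgue_measurableI; last apply: lebesgue_measurableC;
  exact: lebesgue_measurable_lt.
Qed.

Lemma color_set_widen m m' A : m <= m' -> color_set m A -> color_set m' A.
Proof. by move=> mm' [Am mA]; split=> // x /Am; rewrite /Ico /=; lra. Qed.

Lemma color_set0 m : color_set m set0.
Proof.
have -> : set0 = Ico 0 m `\` Ico 0 m by rewrite setDv.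
by apply: color_setD; apply: color_set_Ico.
Qed.

Lemma mu0 : mu set0 = 0.
Proof.
have -> : set0 = Ico 0 0 by apply/seteqP; split=> x //=; rewrite /Ico /=; lra.
by rewrite mu_Ico //; right.
Qed.

Lemma mu_setU m A B : color_set m A -> color_set m B -> A `&` B = set0 ->
  mu (A `|` B) = mu A + mu B.
Proof.
move=> cA cB AB0; rewrite (mu_split cA.2); last by apply: finite_outerU; eauto.
by rewrite setUK setDUl setDv set0U [B `\` A]setDidl // setIC.
Qed.

Lemma mu_setD m A B : color_set m A -> color_set m B -> B `<=` A ->
  mu (A `\` B) = mu A - mu B.
Proof.
move=> cA cB BA; rewrite (@mu_split A B cB.2) ?(setIidr BA); first by lra.
exact: color_set_finite cA.
Qed.

Lemma unit_color_setP m A : unit_color_set m A <-> color_set m A /\ mu A = 1.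
Proof.
split=> [[Am [mA A1]]|[cA A1]]; first by split=> //; apply: mu_eq.
split; first exact: cA.1; split; first exact: cA.2.
by rewrite -A1; apply: muP; apply: color_set_finite cA.
Qed.

Lemma mu_lt_lipschitz m A s t : color_set m A -> s <= t ->
  mu (A `&` [set x | x < s]) <= mu (A `&` [set x | x < t])
    <= mu (A `&` [set x | x < s]) + (t - s).
Proof.
move=> cA st; split.
  apply: mu_le; last by apply: color_set_finite (color_set_lt _ cA).
  by move=> x [Ax]; split=> //=; move: b => /=; lra.
have fs := color_set_finite (color_set_lt s cA).
have fst := finite_outer_Ico st.
apply: Rle_trans (Rplus_le_compat_l _ _ _ (mu_le_cover (interval_cover_Ico st))).
apply: Rle_trans (mu_subadd fs fst); apply: mu_le; last exact: finite_outerU.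
move=> x [Ax /= xt]; have [xs|xs] := Rlt_le_dec x s; first by left.
by right; rewrite /Ico /=.
Qed.

(** An intermediate value argument: the measure of [A] below [t] is nondecreasing and 1-Lipschitz in
    [t], and runs from 0 to [mu A]. *)
Lemma initial_segment m A r : 0 <= m -> color_set m A -> 0 <= r <= mu A ->
  exists t, mu (A `&` [set x | x < t]) = r.
Proof.
move=> m0 cA rA; pose F t := mu (A `&` [set x | x < t]).
have F0 : F 0 = 0.
  rewrite /F (_ : _ `&` _ = set0) ?mu0 //.
  by apply/seteqP; split=> x // [/cA.1]; rewrite /Ico /=; lra.
have Fm : F m = mu A.
  rewrite /F (_ : _ `&` _ = A) //.
  apply/seteqP; split=> [x []//|x Ax]; split=> //.
  by have := cA.1 _ Ax; rewrite /Ico /=; lra.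
pose low t := t <= m /\ F t <= r.
have [||t [tub tlub]] := completeness low.
- by exists m => t [].
- by exists 0; split=> //; rewrite F0; lra.
have t0 : 0 <= t by apply: tub; split=> //; rewrite F0; lra.
have tm : t <= m by apply: tlub => y [].
(* If F t > r, a point of [low] closer to [t] than F t - r violates the Lipschitz bound. If F t < r,
   then [t] can be moved right by r - F t, or up to [m], and stay in [low]. *)
exists t; apply: Rle_antisym; apply: Rnot_lt_le => lt.
  have [t' lt' t't] : exists2 t', low t' & t - (F t - r) < t'.
    apply: contrapT => /forall2NP H.
    have : t <= t - (F t - r); last by rewrite /F; lra.
    by apply: tlub => y ly; case: (H y) => // h; lra.
  have := (@mu_lt_lipschitz m A t' t cA (tub _ lt')).2.
  by case: lt' => _; rewrite /F; rewrite /F in t't; lra.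
have tm' : t <> m by move=> tm'; move: lt; rewrite tm' -/(F m) Fm; lra.
pose t' := Rmin m (t + (r - F t)).
have tt' : t < t' <= t + (r - F t).
  by rewrite -/(F t) in lt; rewrite /t' /Rmin; case: Rle_dec; lra.
have : t' <= t; last lra.
apply: tub; split; first exact: Rmin_l.
have := (@mu_lt_lipschitz m A t t' cA ltac:(lra)).2; rewrite -/(F t) -/(F t'); lra.
Qed.

Lemma color_subset m A r : 0 <= m -> color_set m A -> 0 <= r <= mu A ->
  exists2 B, color_set m B & B `<=` A /\ mu B = r.
Proof.
move=> m0 cA rA; have [t tr] := initial_segment m0 cA rA.
by exists (A `&` [set x | x < t]); [exact: color_set_lt|split=> // x []].
Qed.

(** * Evenly mixed subsets *)

Lemma disjointS (A A' B B' : set R) :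
  A' `&` B' = set0 -> A `<=` A' -> B `<=` B' -> A `&` B = set0.
Proof. by rewrite -!subset0 => h AA BB x [/AA ? /BB ?]; apply: h; split. Qed.

Lemma setI_setD_disjoint (A B : set R) : (A `&` B) `&` (B `\` A) = set0.
Proof. by rewrite -subset0 => x [[Ax _] [_]]. Qed.

Lemma setI_setD_union (A B : set R) : (A `&` B) `|` (B `\` A) = B.
Proof. by rewrite setIC setUIDK. Qed.

(** A growing family in [B] indexed by the fraction of its measure. The ends are exactly the empty
    set and [B], not merely up to null sets, because colorings must be disjoint and agree
    pointwise. *)
Record filtration (m : R) (B : set R) (Z : R -> set R) : Prop := Filtration {
  filtration0 : Z 0 = set0;
  filtration1 : Z 1 = B;
  filtration_le : forall t t', 0 <= t -> t <= t' -> t' <= 1 -> Z t `<=` Z t';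
  filtration_color_set : forall t, 0 <= t <= 1 -> color_set m (Z t);
  filtration_mu : forall t, 0 <= t <= 1 -> mu (Z t) = t * mu B }.

Lemma filtration_sub m B Z t : filtration m B Z -> 0 <= t <= 1 -> Z t `<=` B.
Proof.
by move=> fZ t01; rewrite -(filtration1 fZ); apply: filtration_le fZ _ _ _ _ _; lra.
Qed.

Lemma filtration_exists m B : 0 <= m -> color_set m B ->
  exists Z, filtration m B Z.
Proof.
move=> m0 cB; have muB0 : 0 <= mu B by apply: mu_ge0; eauto.
have /choice[tau tauP] t : exists x, 0 <= t <= 1 ->
    mu (B `&` [set y | y < x]) = t * mu B.
  have [t01|] := EM (0 <= t <= 1); last by exists 0.
  have [|x xt] := @initial_segment m B (t * mu B) m0 cB; last by exists x.
  split; first by apply: Rmult_le_pos; lra.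
  by rewrite -[X in _ <= X]Rmult_1_l; apply: Rmult_le_compat_r; lra.
(* The ends are set by hand to make them exact. For a null [B] the thresholds [tau] carry no order,
   so the empty set is used strictly between the ends. *)
exists (fun t => if Rlt_dec 0 t then if Rlt_dec t 1 then
  if Req_EM_T (mu B) 0 then set0 else B `&` [set y | y < tau t] else B else set0).
split.
- by case: Rlt_dec => // ?; lra.
- case: Rlt_dec => [?|?]; last lra.
  by case: Rlt_dec => // ?; lra.
- move=> t t' t0 tt' t1.
  case: (Rlt_dec 0 t) => [? /=|? x []]; case: (Rlt_dec 0 t') => [? /=|?]; last lra.
  case: (Rlt_dec t' 1) => [? /=|? /=]; last first.
    by case: (Rlt_dec t 1) => ? //=; case: Req_EM_T => ? //= x [].
  case: (Rlt_dec t 1) => [? /=|?]; last lra.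
  case: Req_EM_T => /= [? x []|B0 x [Bx /= xt]]; split=> //=.
  (* Thresholds in the wrong order would give t' ≤ t by comparing measures, as [mu B] is nonzero;
     hence t = t' and equal thresholds. *)
  apply: Rlt_le_trans xt _; apply: Rnot_lt_le => lt.
  have := (@mu_lt_lipschitz m B _ _ cB (Rlt_le _ _ lt)).1.
  rewrite !tauP; try lra.
  move=> le; have tt : t = t'.
    by apply: Rle_antisym => //; apply: (@Rmult_le_reg_r (mu B)) => //; lra.
  by move: lt; rewrite tt; lra.
- move=> t t01; case: (Rlt_dec 0 t) => ? /=; last exact: color_set0.
  case: (Rlt_dec t 1) => ? //=; case: Req_EM_T => ? /=; first exact: color_set0.
  exact: color_set_lt.
- move=> t t01; case: (Rlt_dec 0 t) => ? /=; last by rewrite mu0 (_ : t = 0); lra.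
  case: (Rlt_dec t 1) => ? /=; last by rewrite (_ : t = 1); lra.
  case: Req_EM_T => [B0|?] /=; first by rewrite mu0 B0; lra.
  exact: tauP.
Qed.

(** Induction on the list: [B] is split by [F i], both halves are filtered uniformly for the
    remaining sets, and the filtrations are joined. Then [F i] meets the union exactly in the first
    one. *)
Lemma uniform_filtration (I : eqType) (F : I -> set R) (s : seq I) m B :
  0 <= m -> (forall i, i \in s -> color_set m (F i)) -> color_set m B ->
  exists2 Z, filtration m B Z &
    forall t i, 0 <= t <= 1 -> i \in s -> mu (F i `&` Z t) = t * mu (F i `&` B).
Proof.
move=> m0; elim: s B => [|i s IH] B cF cB.
  by have [Z fZ] := filtration_exists m0 cB; exists Z.
have cFi := cF i (mem_head i s).
have cFs j : j \in s -> color_set m (F j) by move=> js; apply: cF; rewrite inE js orbT.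
have [Z1 fZ1 uZ1] := IH (F i `&` B) cFs (color_setI cFi cB).
have [Z2 fZ2 uZ2] := IH (B `\` F i) cFs (color_setD cB cFi).
have dis t : 0 <= t <= 1 -> Z1 t `&` Z2 t = set0.
  move=> t01; apply: disjointS (setI_setD_disjoint (F i) B) _ _;
    [exact: filtration_sub fZ1 t01|exact: filtration_sub fZ2 t01].
have c1 t : 0 <= t <= 1 -> color_set m (Z1 t) by move=> t01; apply: (filtration_color_set fZ1 t01).
have c2 t : 0 <= t <= 1 -> color_set m (Z2 t) by move=> t01; apply: (filtration_color_set fZ2 t01).
have muB C : color_set m C -> mu (C `&` B) =
    mu (C `&` (F i `&` B)) + mu (C `&` (B `\` F i)).
  move=> cC; rewrite (@mu_split (C `&` B) (F i) cFi.2).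
    by congr (mu _ + mu _); rewrite ?setIDA // -setIA (setIC B).
  by apply: color_set_finite (color_setI cC cB).
exists (fun t => Z1 t `|` Z2 t).
  split.
  - by rewrite (filtration0 fZ1) (filtration0 fZ2) setU0.
  - by rewrite (filtration1 fZ1) (filtration1 fZ2) setI_setD_union.
  - by move=> t t' t0 tt' t1; apply: setUSS;
      [apply: (filtration_le fZ1)|apply: (filtration_le fZ2)].
  - by move=> t t01; apply: color_setU; [exact: c1|exact: c2].
  move=> t t01; rewrite (mu_setU (c1 t t01) (c2 t t01) (dis t t01)).
  rewrite (filtration_mu fZ1 t01) (filtration_mu fZ2 t01) -{3}[B]setIid.
  rewrite (muB _ cB) setICA setIid [B `&` (B `\` _)]setIDA setIid; lra.
move=> t j t01; rewrite inE => /orP[/eqP->|js].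
  rewrite (_ : _ `&` _ = Z1 t); first exact: (filtration_mu fZ1 t01).
  apply/seteqP; split=> x; first by move=> [Fx [//|/(filtration_sub fZ2 t01)[]]].
  by move=> Zx; split; [have [] := filtration_sub fZ1 t01 Zx|left].
have cj := cFs j js.
rewrite setIUr (@mu_setU m).
- by rewrite uZ1 // uZ2 // (muB _ cj); lra.
- by apply: color_setI => //; apply: c1.
- by apply: color_setI => //; apply: c2.
by apply: disjointS (dis t t01) _ _ => x [].
Qed.

(* Each set [c v] is copied to a set [f v] in such a way that the densities
   [p i] of the sets [F i] in [B] become their densities in each [f v]. *)
Lemma uniform_transport (I : eqType) (F : I -> set R) (si : seq I) (p : I -> R)
    (V : eqType) (c : V -> set R) (s : seq V) m A B :
  0 <= m -> (forall i, i \in si -> color_set m (F i)) ->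
  (forall v, v \in s -> color_set m (c v)) ->
  color_set m A -> color_set m B -> mu A = mu B ->
  (forall i, i \in si -> mu (F i `&` B) = p i * mu B) ->
  exists f : V -> set R,
    [/\ forall v, v \in s -> color_set m (f v) /\ f v `<=` B,
        forall v, v \in s -> mu (f v) = mu (A `&` c v),
        forall v i, v \in s -> i \in si -> mu (F i `&` f v) = p i * mu (f v) &
        forall u v, u \in s -> v \in s ->
          A `&` (c u `&` c v) = set0 -> f u `&` f v = set0].
Proof.
move=> m0 cF; elim: s A B => [|v s IH] A B cc cA cB AB pB.
  by exists c; split.
have cv := cc v (mem_head v s).
have cs u : u \in s -> color_set m (c u) by move=> us; apply: cc; rewrite inE us orbT.
have cAv := color_setI cA cv.
have AvA : mu (A `&` c v) <= mu A by apply: mu_le; [move=> x []|eauto].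
have Av0 : 0 <= mu (A `&` c v) by apply: mu_ge0; eauto.
(* The fraction of [A] taken by [c v]. It must be 0 when that part is null, even for a null [A], so
   that an empty class is copied to the empty set. *)
have [t t01 tA] : exists2 t, 0 <= t <= 1 & mu (A `&` c v) = t * mu A /\
    (mu (A `&` c v) = 0 -> t = 0).
  have [A0|A0] := Req_EM_T (mu A) 0.
    by exists 0; [lra|split=> //; move: AvA; rewrite A0; lra].
  exists (mu (A `&` c v) / mu A); last first.
    by split=> [|->]; [field|rewrite /Rdiv Rmult_0_l].
  split; first by apply: Rle_mult_inv_pos; lra.
  by apply: (@Rmult_le_reg_r (mu A)); [lra|rewrite /Rdiv Rmult_assoc Rinv_l // ; lra].
have [Z fZ uZ] := uniform_filtration m0 cF cB.
have cZ := filtration_color_set fZ t01.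
have ZB := filtration_sub fZ t01.
have muZ := filtration_mu fZ t01.
have AZ : mu (A `&` c v) = mu (Z t) by rewrite muZ -AB tA.1.
(* [c v] is copied to [Z t]. The remaining classes are copied separately inside [c v] into [Z t] and
   outside [c v] into its complement, then joined. *)
have [|f1 [h1 h2 h3 h4]] := IH (A `&` c v) (Z t) cs cAv cZ AZ.
  by move=> i isi; rewrite uZ // pB // muZ; lra.
have cBZ := color_setD cB cZ.
have muBZ : mu (B `\` Z t) = mu B - mu (Z t) by apply: mu_setD cB cZ ZB.
have AZ' : mu (A `\` c v) = mu (B `\` Z t).
  by rewrite muBZ -AZ -AB (@mu_split A (c v) cv.2); [lra|eauto].
have [|f2 [g1 g2 g3 g4]] := IH (A `\` c v) (B `\` Z t) cs (color_setD cA cv) cBZ AZ'.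
  move=> i isi; have cFi := cF i isi.
  rewrite muBZ; have := pB i isi; rewrite (@mu_split (F i `&` B) (Z t) cZ.2).
    rewrite -setIA (setIidr ZB) uZ // setIDA muZ pB //; lra.
  exact: color_set_finite (color_setI cFi cB).
have ZD : Z t `&` (B `\` Z t) = set0 by rewrite -subset0 => x [? []].
have dis u u' : u \in s -> u' \in s -> f1 u `&` f2 u' = set0.
  by move=> us us'; apply: disjointS ZD _ _; [apply: (h1 u us).2|apply: (g1 u' us').2].
have in_s u : u \in v :: s -> u != v -> u \in s.
  by rewrite inE => /orP[->|].
have vu0 u : u \in s -> A `&` (c v `&` c u) = set0 -> Z t `&` (f1 u `|` f2 u) = set0.
  move=> us e0; rewrite setIUr.
  (* The disjointness clause with both vertices equal to [u] turns an empty trace on [c v] into an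
     empty copy. *)
  have f0 : f1 u = set0 by rewrite -[f1 u]setIid h4 // setIid -setIA.
  rewrite f0 setI0 set0U; apply: disjointS ZD _ _ => //; exact: (g1 u us).2.
exists (fun u => if u == v then Z t else f1 u `|` f2 u); split.
- move=> u us; case: eqVneq => // uv; have {}us := in_s u us uv.
  have [? ?] := h1 u us; have [? ?] := g1 u us.
  split; first exact: color_setU.
  by rewrite subUset; split; [apply: subset_trans ZB|
    apply: (subset_trans (B := B `\` Z t)) => // x []].
- move=> u us; case: eqVneq => [->|uv]; first by [].
  have {}us := in_s u us uv.
  rewrite (mu_setU (h1 u us).1 (g1 u us).1 (dis u u us us)) h2 // g2 //.
  rewrite (@mu_split (A `&` c u) (c v) cv.2).
    by congr (mu _ + mu _); [rewrite -!setIA (setIC (c v))|rewrite setIDAC setIDA].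
  exact: color_set_finite (color_setI cA (cs u us)).
- move=> u i us isi; case: eqVneq => [_|uv].
    by rewrite uZ // pB // muZ; lra.
  have {}us := in_s u us uv; have cFi := cF i isi.
  rewrite setIUr (mu_setU (h1 u us).1 (g1 u us).1 (dis u u us us)).
  rewrite (mu_setU (color_setI cFi (h1 u us).1) (color_setI cFi (g1 u us).1)).
    by rewrite h3 // g3 //; lra.
  by apply: disjointS (dis u u us us) _ _ => x [].
move=> u u' us us'.
case: (eqVneq u v) => [->|uv]; case: (eqVneq u' v) => [->|u'v].
- rewrite setIid => e0; rewrite (_ : t = 0) ?(filtration0 fZ) ?setI0 //.
  by apply: tA.2; rewrite e0 mu0.
- by move=> e0; apply: vu0 => //; apply: in_s.
- by rewrite (setIC (c u)) [_ `&` Z t]setIC => e0; apply: vu0 => //; apply: in_s.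
have {}us := in_s u us uv; have {}us' := in_s u' us' u'v.
move=> e0; have e1 : f1 u `&` f1 u' = set0.
  by apply: h4 => //; rewrite setIAC e0 set0I.
have e2 : f2 u `&` f2 u' = set0.
  by apply: g4 => //; rewrite setIDAC setIDA e0 set0D.
by rewrite setIUl !setIUr e1 e2 dis // [f2 u `&` _]setIC dis // !setU0.
Qed.

(** * Walks *)

Fixpoint walk (V : finType) (e : rel V) (n : nat) (u v : V) : bool :=
  if n is n'.+1 then [exists z, e u z && walk e n' z v] else u == v.

Lemma walk_path (V : finType) (e : rel V) n u v : walk e n u v ->
  exists p, [/\ path e u p, last u p = v & size p = n].
Proof.
elim: n u => [|n IH] u /=; first by move=> /eqP ->; exists [::].
move=> /existsP[z /andP[uz /IH[p [zp pv pn]]]].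
by exists (z :: p); split; rewrite /= ?uz ?pn.
Qed.

Lemma walk_cat (V : finType) (e : rel V) i j u z v :
  walk e i u z -> walk e j z v -> walk e (i + j) u v.
Proof.
elim: i u => [|i IH] u /=; first by move=> /eqP ->.
move=> /existsP[y /andP[uy yz]] zv; apply/existsP; exists y.
by rewrite uy; apply: IH.
Qed.

Lemma walk1 (V : finType) (e : rel V) u v : e u v -> walk e 1 u v.
Proof. by move=> uv; apply/existsP; exists v; rewrite uv /=. Qed.

Lemma walk_sym (V : finType) (e : rel V) n u v : symmetric e ->
  walk e n u v -> walk e n v u.
Proof.
move=> esym; elim: n u => [|n IH] u /=; first by rewrite eq_sym.
move=> /existsP[z /andP[uz /IH zv]].
by move: uz; rewrite esym => /walk1/(walk_cat zv); rewrite addn1.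
Qed.

(** The distance truncated at [N]: [find] returns the length [N] of the list when there is no
    shorter walk. *)
Definition capped_dist (V : finType) (e : rel V) (N : nat) (w v : V) : nat :=
  find (fun n => walk e n w v) (iota 0 N).

Lemma walk_capped_dist (V : finType) (e : rel V) N w v :
  (capped_dist e N w v < N)%N -> walk e (capped_dist e N w v) w v.
Proof.
move=> DN; have DN' := DN; rewrite -{2}(size_iota 0 N) -has_find in DN.
by have := nth_find 0%N DN; rewrite -/(capped_dist e N w v) nth_iota.
Qed.

Lemma capped_dist_le (V : finType) (e : rel V) N w v : (capped_dist e N w v <= N)%N.
Proof. by rewrite -{2}(size_iota 0 N) find_size. Qed.

Lemma capped_dist_walk (V : finType) (e : rel V) N w v n :
  walk e n w v -> (capped_dist e N w v <= n)%N.
Proof.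
move=> wn; have [nN|Nn] := ltnP n N; last exact: leq_trans (capped_dist_le _ _ _ _) Nn.
rewrite leqNgt; apply/negP => lt.
by have := before_find 0%N lt; rewrite nth_iota // add0n wn.
Qed.

Lemma capped_dist_edge (V : finType) (e : rel V) N w u v :
  e u v -> (capped_dist e N w v <= (capped_dist e N w u).+1)%N.
Proof.
move=> uv; have [lt|ge] := ltnP (capped_dist e N w u) N.
  rewrite -addn1; apply: capped_dist_walk.
  by apply: walk_cat (walk_capped_dist lt) (walk1 uv).
by apply: leq_trans (capped_dist_le _ _ _ _) _; apply: leqW.
Qed.

(** * Color overlap along short walks *)

(** A fractional k-coloring whose color space is a subset [C] of [0,m) of measure [k] in place of
    [0,k). *)
Record fractional_system (V : finType) (e : rel V) (m k : R) (C : set R)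
    (c : V -> set R) : Prop := FractionalSystem {
  system_color_set : color_set m C;
  system_mu : mu C = k;
  system_sub : forall v, c v `<=` C;
  system_color_setE : forall v, color_set m (c v);
  system_muE : forall v, mu (c v) = 1;
  system_disjoint : forall u v, e u v -> c u `&` c v = set0 }.

(** Two neighbors of [z] use only [C] minus [c z], of measure k - 1, so their classes differ by at
    most k - 2. The differences add up over the double steps of the walk. *)
Lemma even_walk_overlap (V : finType) (e : rel V) m k C c i u v :
  fractional_system e m k C c -> walk e i.*2 u v ->
  mu (c u `\` c v) <= INR i * (k - 2).
Proof.
move=> S; have cE := system_color_setE S; have cC := system_color_set S.
elim: i u => [|i IH] u /=; first by move=> /eqP ->; rewrite setDv mu0; lra.
move=> /existsP[z /andP[uz /existsP[y /andP[zy yv]]]].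
have fE v' : finite_outer (c v') by apply: color_set_finite (cE v').
have h1 : mu (c u `\` c y) <= k - 2.
  have cCz : color_set m (C `\` c z) by apply: color_setD.
  have sub : c y `<=` C `\` c z.
    move=> x yx; split; first exact: (system_sub S yx).
    by move=> zx; have := system_disjoint S zy; rewrite -subset0 => /(_ x (conj zx yx)).
  have -> : k - 2 = mu ((C `\` c z) `\` c y).
    rewrite (mu_setD cCz (cE y) sub) (mu_setD cC (cE z) (system_sub S (v:=z))).
    by rewrite (system_mu S) !(system_muE S); lra.
  apply: mu_le; last by apply: color_set_finite (color_setD cCz (cE y)).
  move=> x [ux nyx]; split=> //; split; first exact: (system_sub S ux).
  by move=> zx; have := system_disjoint S uz; rewrite -subset0 => /(_ x (conj ux zx)).
have {}IH := IH y yv.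
have f1 := color_set_finite (color_setD (cE u) (cE y)).
have f2 := color_set_finite (color_setD (cE y) (cE v)).
have h2 : mu (c u `\` c v) <= mu (c u `\` c y) + mu (c y `\` c v).
  apply: Rle_trans (mu_subadd f1 f2); apply: mu_le; last exact: finite_outerU.
  by move=> x [ux nvx]; have [yx|nyx] := EM (c y x); [right|left].
by rewrite -/(INR i.+1) S_INR; lra.
Qed.

(** Going back through [w] joins [u] to [v] by a walk of length 2i, so their classes differ by less
    than 1 and cannot be disjoint. *)
Lemma sphere_independent (V : finType) (e : rel V) m k C c i w u v :
  symmetric e -> fractional_system e m k C c -> INR i * (k - 2) < 1 ->
  walk e i w u -> walk e i w v -> e u v -> False.
Proof.
move=> esym S ik wu wv uv.
have uv2 : walk e i.*2 u v by rewrite -addnn; apply: walk_cat (walk_sym esym wu) wv.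
have := even_walk_overlap S uv2.
by rewrite (setDidl (system_disjoint S uv)) (system_muE S); lra.
Qed.

(** * Exchanging colors around a precolored vertex *)

(* [gain j] is the measure of the colors that can be exchanged at distance
   [2 (d' - j) + 1] from a precolored vertex. *)
Fixpoint gain (m r eps : R) (j : nat) : R :=
  if j is j'.+1 then Rmin (1 / m) (r ^ 2 * gain m r eps j' + eps) else 0.

Lemma gainS m r eps j :
  gain m r eps j.+1 = Rmin (1 / m) (r ^ 2 * gain m r eps j + eps).
Proof. by []. Qed.

Lemma gain_bounds m r eps j : 0 < m -> 1 <= r -> 0 < eps ->
  0 <= gain m r eps j <= 1 / m.
Proof.
move=> m0 r1 e0; have im : 0 < 1 / m by apply: Rdiv_lt_0_compat; lra.
elim: j => [|j IH] /=; first lra.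
split; last exact: Rmin_l.
by apply: Rmin_glb; [lra|nra].
Qed.

Lemma gain_leS m r eps j : 0 < m -> 1 <= r -> 0 < eps ->
  gain m r eps j <= gain m r eps j.+1.
Proof.
move=> m0 r1 e0; have b := gain_bounds j m0 r1 e0.
have r2 : 1 <= r ^ 2 by nra.
rewrite gainS; set g := gain _ _ _ _ in b *.
by apply: Rmin_glb; [lra|nra].
Qed.

Lemma rsumS n f : rsum n.+1 f = f 0%N + rsum n (fun i => f i.+1).
Proof. by elim: n => [|n IH] /=; [lra|rewrite -Rplus_assoc -IH]. Qed.

(** Unrolling the recursion produces the sum while the cap 1/m is inactive; once it is active, the
    factor r ^ 2 ≥ 1 preserves the bound 1/m. *)
Lemma gain_lower m r eps n : 0 < m -> 1 <= r -> 0 < eps ->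
  Rmin (1 / m) (eps * rsum n (fun j => r ^ (2 * j + 2))) <= r ^ 2 * gain m r eps n.
Proof.
move=> m0 r1 e0; have im : 0 < 1 / m by apply: Rdiv_lt_0_compat; lra.
have r2 : 1 <= r ^ 2 by nra.
elim: n => [|n IH]; first by apply: Rle_trans (Rmin_r _ _) _ => /=; lra.
(* Horner form, which matches one step of the recursion of [gain]. *)
have sumS : rsum n.+1 (fun j => r ^ (2 * j + 2)) =
    r ^ 2 * (1 + rsum n (fun j => r ^ (2 * j + 2))).
  rewrite rsumS Rmult_plus_distr_l Rmult_1_r; congr (_ + _).
  elim: n {IH} => [|n IH]; first by rewrite /=; lra.
  have sumE f : rsum n.+1 f = rsum n f + f n by [].
  rewrite !sumE IH Rmult_plus_distr_l; congr (_ + _).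
  by rewrite mulnS -addnA -(pow_add r 2).
rewrite sumS gainS.
have g0 := gain_bounds n m0 r1 e0.
move: (r ^ 2) r2 IH => q q1; move: (rsum _ _) (gain _ _ _ _) g0 => a g g0.
move=> IH; case: (Rle_lt_dec (1 / m) (q * g + eps)) => h.
  by rewrite (Rmin_left _ _ h); apply: Rle_trans (Rmin_l _ _) _; nra.
rewrite (Rmin_right _ _ (Rlt_le _ _ h)); apply: Rle_trans (Rmin_r _ _) _.
have : eps * a <= q * g by move: IH; rewrite /Rmin; case_Rle; lra.
nra.
Qed.

(* The colors exchanged at level [i] around a vertex precolored with [P]
   lie in [P] for odd [i] and outside [P] for even [i]. *)
Record exchange (V : finType) (c : V -> set R) (m k : R) (C P : set R)
    (g : nat -> R) (U : nat -> set R) : Prop := Exchange {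
  exchange_color_set : forall i, color_set m (U i);
  exchange_odd : forall i, odd i -> U i `<=` P `&` C;
  exchange_even : forall i, ~~ odd i -> U i `<=` C `\` P;
  exchange_le : forall i, U i.+2 `<=` U i;
  exchange_muI : forall i v, mu (c v `&` U i) = g i;
  exchange_mu : forall i, mu (U i) = k * g i;
  exchange0 : forall i, g i = 0 -> U i = set0;
  exchange_full : forall i, odd i -> g i = 1 / m -> U i = P `&` C }.

(** Odd levels are taken from a filtration of P ∩ C, even levels from one of [C] minus [P], both
    uniform for all color classes. *)
Lemma exchange_exists (V : finType) (e : rel V) (c : V -> set R) m k C P g :
  1 < m -> fractional_system e m k C c ->
  color_set m P -> mu (P `&` C) = 1 / m * k ->
  (forall v, mu (P `&` c v) = 1 / m) ->
  (forall i, 0 <= g i) -> (forall i, g i.+2 <= g i) ->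
  (forall i, g i <= if odd i then 1 / m else (m - 1) / m) ->
  exists U, exchange c m k C P g U.
Proof.
move=> m1 S cP muPC muPc g0 gle gub.
have cC := system_color_set S; have cc := system_color_setE S.
have cPC := color_setI cP cC; have cCP := color_setD cC cP.
have m0 : 0 <= m by lra.
have mn0 : m <> 0 by move=> ?; lra.
have mn1 : m - 1 <> 0 by move=> ?; lra.
have [Z fZ uZ] := uniform_filtration (s := enum V) m0 (fun v _ => cc v) cPC.
have [Y fY uY] := uniform_filtration (s := enum V) m0 (fun v _ => cc v) cCP.
have muCP : mu (C `\` P) = (m - 1) / m * k.
  have := mu_split cP.2 (color_set_finite cC).
  rewrite setIC muPC (system_mu S) => h.
  have -> : mu (C `\` P) = k - 1 / m * k by lra.
  by field.
have cPCI v : c v `&` (P `&` C) = P `&` c v.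
  by rewrite setICA (setIidl (system_sub S (v:=v))).
have muCPc v : mu (c v `&` (C `\` P)) = (m - 1) / m.
  have -> : c v `&` (C `\` P) = c v `\` P by rewrite setIDA (setIidl (system_sub S (v:=v))).
  have := mu_split cP.2 (color_set_finite (cc v)).
  rewrite setIC muPc (system_muE S) => h.
  have -> : mu (c v `\` P) = 1 - 1 / m by lra.
  by field.
(* A class has measure 1/m inside [P] and (m - 1)/m outside; these fractions make it give up exactly
   [g i]. *)
pose t i := if odd i then m * g i else m / (m - 1) * g i.
have cst : 0 < m / (m - 1) by apply: Rdiv_lt_0_compat; lra.
have t01 i : 0 <= t i <= 1.
  have := g0 i; have := gub i; rewrite /t; case: ifP => _ gu g0i; split; try nra.
    apply: (Rle_trans _ (m * (1 / m))); last by right; field.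
    by apply: Rmult_le_compat_l; lra.
  apply: (Rle_trans _ (m / (m - 1) * ((m - 1) / m))); last by right; field.
  by apply: Rmult_le_compat_l; lra.
have tle i : t i.+2 <= t i.
  by have := gle i; rewrite /t /= negbK; case: ifP => _ ?; apply: Rmult_le_compat_l; lra.
exists (fun i => if odd i then Z (t i) else Y (t i)); split.
- by move=> i; case: ifP => _; [exact: (filtration_color_set fZ (t01 i))|
    exact: (filtration_color_set fY (t01 i))].
- by move=> i ->; apply: (filtration_sub fZ (t01 i)).
- by move=> i /negbTE ->; apply: (filtration_sub fY (t01 i)).
- move=> i; have := tle i; have := t01 i; have := t01 i.+2; rewrite /= negbK => h1 h2 h3.
  by case: ifP => _; [apply: (filtration_le fZ)|apply: (filtration_le fY)]; lra.
- move=> i v; case: ifP => oi.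
    by rewrite uZ ?mem_enum // cPCI muPc /t oi; field.
  by rewrite uY ?mem_enum // muCPc /t oi; field.
- move=> i; case: ifP => oi.
    by rewrite (filtration_mu fZ) // muPC /t oi; field.
  by rewrite (filtration_mu fY) // muCP /t oi; field.
- move=> i gi; rewrite /t gi; case: (odd i); rewrite Rmult_0_r.
    exact: (filtration0 fZ).
  exact: (filtration0 fY).
move=> i oi gi; rewrite oi /t oi gi.
have -> : m * (1 / m) = 1 by field.
exact: (filtration1 fZ).
Qed.

(** * Recoloring from palettes *)

(** The part of [c] in [A] is replaced by a set of equal measure from [B] minus [c] and [X], which
    are disjoint since [X] avoids [C]. *)
Lemma recolor m (C c A B X : set R) :
  0 <= m -> color_set m c -> c `<=` C -> color_set m A -> color_set m B ->
  color_set m X -> X `&` C = set0 -> B `<=` C -> mu c = 1 ->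
  mu (c `&` A) <= mu B - mu (c `&` B) + mu X ->
  exists f, [/\ color_set m f, mu f = 1 & f `<=` (c `\` A) `|` (B `|` X)].
Proof.
move=> m0 cc cC cA cB cX XC BC c1 le.
have cBc := color_setD cB cc.
have muY : mu ((B `\` c) `|` X) = mu B - mu (c `&` B) + mu X.
  rewrite (mu_setU cBc cX).
    by rewrite (@mu_split B c cc.2) 1?(setIC c) //; [lra|eauto].
  by rewrite setIC; apply: disjointS XC _ _ => // x [/BC].
have cY := color_setU cBc cX.
have r0 : 0 <= mu (c `&` A) <= mu ((B `\` c) `|` X).
  by rewrite muY; split=> //; apply: mu_ge0; apply: color_set_finite (color_setI cc cA).
have [Z cZ [ZY muZ]] := color_subset m0 cY r0.
exists ((c `\` A) `|` Z); split.
- by apply: color_setU => //; apply: color_setD.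
- rewrite (mu_setU (color_setD cc cA) cZ).
    rewrite muZ -c1 [mu c in RHS](@mu_split c A cA.2); [lra|eauto].
  rewrite -subset0 => x [[cx _] /ZY[[_ ncx]//|Xx]].
  by move: XC; rewrite -subset0 => /(_ x); apply; split=> //; apply: cC.
by apply: setUS => x /ZY[[Bx _]|Xx]; [left|right].
Qed.

(** Only every second level may use [E], so adjacent levels do not compete for it. Level 1 must also
    avoid [P], all of which is used at level 0. *)
Definition spare (E P : set R) (i : nat) : set R :=
  if odd i then if i == 1%N then E `\` P else E else set0.

(** Colors allowed at level [i], possibly of measure above 1: [U i] is given up to the next inner
    level, [U i.+1] is received from the next outer one. *)
Definition palette (E P c : set R) (U : nat -> set R) (i : nat) : set R :=
  if i is 0%N then P else (c `\` U i) `|` (U i.+1 `|` spare E P i).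

(** Colors received at one level are given up at the next outer one; [U i.+2] lies in [U i], already
    given up at level [i]; [U i.+1] and [U i.+2] lie on opposite sides of [P]. At level 0, g 1 = 1/m
    makes level 1 give up all of P ∩ C. *)
Lemma palette_disjoint (V : finType) (c : V -> set R) m k C P E g U i u v :
  exchange c m k C P g U -> g 1%N = 1 / m -> E `&` C = set0 ->
  c u `<=` C -> c v `<=` C -> c u `&` c v = set0 ->
  palette E P (c u) U i `&` palette E P (c v) U i.+1 = set0.
Proof.
move=> X g1; rewrite -!subset0 => EC uC vC uv x.
have U1 := exchange_full X (isT : odd 1) g1.
have {uv} := uv x; have {EC} := EC x; have {vC} := vC x; have {uC} := uC x.
case: i => [|i]; rewrite /palette /spare /setI /setD /setU /mkset /=.
  by have := @exchange_even _ _ _ _ _ _ _ _ X 2 isT x; rewrite U1 /setI /setD /mkset; tauto.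
rewrite negbK; have := @exchange_le _ _ _ _ _ _ _ _ X i.+1 x.
have := @exchange_odd _ _ _ _ _ _ _ _ X; have := @exchange_even _ _ _ _ _ _ _ _ X.
case: (boolP (odd i)) => oi even odd.
  have := even i.+1 ltac:(by rewrite /= negbK) x.
  have := odd i.+2 ltac:(by rewrite /= negbK) x.
  by rewrite /setI /setD /mkset; case: ifP => _; tauto.
have := odd i.+1 oi x; have := even i.+2 ltac:(by rewrite /= negbK) x.
by rewrite /setI /setD /mkset; case: ifP => _; tauto.
Qed.

(** The class loses [g i.+1]. Of the measure k g(i+2) offered it already owns g(i+2), so (k - 1)
    g(i+2) and the spare colors are new. *)
Lemma palette_coloring (V : finType) (e : rel V) (c : V -> set R) m k C P g U i v :
  0 <= m -> fractional_system e m k C c -> color_set m P ->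
  exchange c m k C P g U ->
  g i.+1 <= (k - 1) * g i.+2 + mu (spare (Ico 0 m `\` C) P i.+1) ->
  exists f, [/\ color_set m f, mu f = 1 &
    f `<=` palette (Ico 0 m `\` C) P (c v) U i.+1].
Proof.
move=> m0 S cP X le; have cC := system_color_set S.
have cE := color_setD (color_set_Ico m) cC.
have cspare j : color_set m (spare (Ico 0 m `\` C) P j).
  rewrite /spare; case: ifP => _; last exact: color_set0.
  by case: ifP => // _; apply: color_setD.
have spareC : spare (Ico 0 m `\` C) P i.+1 `&` C = set0.
  rewrite -subset0 => x [+ Cx]; rewrite /spare; case: ifP => // _.
  by case: ifP => _; [move=> [[_ nC]]|move=> [_ nC]].
apply: (recolor m0 (system_color_setE S v) (system_sub S (v := v))
  (exchange_color_set X i.+1) (exchange_color_set X i.+2) (cspare _) spareC).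
- case: (boolP (odd i.+2)) => oi; first by move=> x /(exchange_odd X oi)[].
  by move=> x /(exchange_even X oi)[].
- exact: system_muE S v.
by rewrite !(exchange_muI X) (exchange_mu X); lra.
Qed.

(** * Mixing the coloring with the precoloring *)

(** [C] is the fraction k/m of [0,m), taken uniformly for all precolored sets; the k-coloring is
    then transported from [0,k) into [C], keeping the densities in every class. *)
Lemma mixed_system (V : finType) (e : rel V) k m (W : {set V}) (phi : V -> set R) :
  0 < k -> k < m -> fractionally_colorable e k ->
  fractional_precoloring W m phi ->
  exists C c, fractional_system e m k C c /\
    forall w, w \in W -> mu (phi w `&` C) = 1 / m * k /\
      forall v, mu (phi w `&` c v) = 1 / m.
Proof.
move=> k0 km [c0 [c0P c0e]] phiP; have m0 : 0 <= m by lra.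
have cphi w : w \in enum W -> color_set m (phi w).
  by rewrite mem_enum => /phiP /unit_color_setP[].
have muphi w : w \in enum W -> mu (phi w) = 1.
  by rewrite mem_enum => /phiP /unit_color_setP[].
have [Z fZ uZ] := uniform_filtration m0 cphi (color_set_Ico m).
have t01 : 0 <= k / m <= 1.
  split; first by apply: Rle_mult_inv_pos; lra.
  by apply: (@Rmult_le_reg_r m); [lra|rewrite /Rdiv Rmult_assoc Rinv_l; lra].
have mn0 : m <> 0 by move=> ?; lra.
have cC := filtration_color_set fZ t01.
have muC : mu (Z (k / m)) = k.
  by rewrite (filtration_mu fZ t01) mu_Ico //; field.
have muphiC w : w \in enum W -> mu (phi w `&` Z (k / m)) = 1 / m * mu (Z (k / m)).
  move=> wW; rewrite uZ // (setIidl (cphi w wW).1) muphi // muC; field.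
  by [].
have kIco : color_set m (Ico 0 k) by apply: color_set_widen (color_set_Ico k); lra.
have cc0 v : v \in enum V -> color_set m (c0 v).
  move=> _; have [cv _] := (unit_color_setP k (c0 v)).1 (c0P v).
  by apply: color_set_widen cv; lra.
have [|c [c1 c2 c3 c4]] := uniform_transport m0 cphi cc0 kIco cC _ muphiC.
  by rewrite mu_Ico // ?muC //; lra.
have mu1 v : mu (c v) = 1.
  have [cv c0v] := (unit_color_setP k (c0 v)).1 (c0P v).
  by rewrite c2 ?mem_enum // (setIidr cv.1).
exists (Z (k / m)), c; split; first split => //.
- by move=> v; apply: (c1 v _).2; rewrite mem_enum.
- by move=> v; apply: (c1 v _).1; rewrite mem_enum.
- move=> u v uv; apply: c4; rewrite ?mem_enum //.
  by rewrite -subset0 => x [_ [ux vx]]; apply: c0e uv x ux vx.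
move=> w wW; split=> [|v]; first by rewrite muphiC ?mem_enum // muC.
by rewrite c3 ?mem_enum // mu1; lra.
Qed.

(** * Balance of gains between levels *)

(** The measure each class gives up at level [i], with r = k - 1. Truncated subtraction makes it
    vanish from level 2d' on. *)
Definition level_gain (m r eps : R) (d' i : nat) : R :=
  if odd i then gain m r eps (d' - i./2) else r * gain m r eps (d' - i./2).

Lemma gain_le m r eps i j : 0 < m -> 1 <= r -> 0 < eps -> (i <= j)%N ->
  gain m r eps i <= gain m r eps j.
Proof.
move=> m0 r1 e0 /subnK <-; elim: (j - i)%N => [|n IH]; first by rewrite add0n; lra.
by apply: Rle_trans IH _; apply: gain_leS.
Qed.

Lemma level_gain_far m r eps d' i : (2 * d' <= i)%N -> level_gain m r eps d' i = 0.
Proof.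
move=> di; have -> : level_gain m r eps d' i =
    if odd i then gain m r eps 0 else r * gain m r eps 0.
  rewrite /level_gain (_ : d' - i./2 = 0)%N //.
  by apply/eqP; rewrite subn_eq0 -(doubleK d') half_leq // -mul2n.
by case: ifP => _ //=; lra.
Qed.

Lemma level_gain_le m r eps d' i : 0 < m -> 1 <= r -> 0 < eps ->
  level_gain m r eps d' i.+2 <= level_gain m r eps d' i.
Proof.
move=> m0 r1 e0; rewrite /level_gain /= negbK.
have le : gain m r eps (d' - i./2.+1) <= gain m r eps (d' - i./2).
  by apply: gain_le => //; apply: leq_sub2l.
by case: ifP => _ //; apply: Rmult_le_compat_l; lra.
Qed.

Lemma level_gain_bounds r eps d' i : 1 <= r -> 0 < eps ->
  0 <= level_gain (r + 1 + eps) r eps d' i <=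
    if odd i then 1 / (r + 1 + eps) else (r + 1 + eps - 1) / (r + 1 + eps).
Proof.
move=> r1 e0; rewrite /level_gain; set m := r + 1 + eps.
have m0 : 0 < m by rewrite /m; lra.
have im : 0 < / m by apply: Rinv_0_lt_compat.
have := gain_bounds (d' - i./2) m0 r1 e0; case: ifP => // _.
set h := gain _ _ _ _ => hb; split; first nra.
apply: (Rle_trans _ (r * (1 / m))); first by apply: Rmult_le_compat_l; lra.
have rm : r <= m - 1 by rewrite /m; lra.
by rewrite /Rdiv Rmult_1_l; apply: Rmult_le_compat_r; lra.
Qed.

(** The balance needed for recoloring when odd levels may use all of [E]. Even levels satisfy it
    with equality; at odd levels the cap only helps. *)
Lemma level_gain_step r eps d' i : 1 <= r -> 0 < eps -> (i < 2 * d')%N ->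
  let m := r + 1 + eps in
  level_gain m r eps d' i <=
    r * level_gain m r eps d' i.+1 + if odd i then eps else 0.
Proof.
move=> r1 e0 id m; rewrite /level_gain /= uphalf_half.
case: (boolP (odd i)) => oi /=; last by rewrite add0n; lra.
have : (i./2 < d')%N.
  rewrite -ltn_double -[d'.*2]mul2n; apply: leq_ltn_trans id.
  by rewrite -{2}(odd_double_half i) leq_addl.
rewrite add1n => /subnSK <-; rewrite gainS.
by apply: Rle_trans (Rmin_r _ _) _; rewrite /=; lra.
Qed.

(** The numerical hypothesis enters here: it yields the second claim, the balance at level 1 with
    the reduced spare set. As (m - 1)/m < 1, the cap 1/m is then attained at level 1. *)
Lemma level_gain1 r eps d' : 1 <= r -> 0 < eps -> (0 < d')%N ->
  let m := r + 1 + eps in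
  eps * rsum (d' - 1) (fun j => r ^ (2 * j + 2)) + eps * ((m - 1) / m) >= 1 / m ->
  level_gain m r eps d' 1 = 1 / m /\
  1 / m <= r * level_gain m r eps d' 2 + eps * ((m - 1) / m).
Proof.
move=> r1 e0 d0 m cond; have m0 : 0 < m by rewrite /m; lra.
have im : 0 < / m by apply: Rinv_0_lt_compat.
have := gain_lower (d' - 1) m0 r1 e0.
rewrite /level_gain /= subn0 -[in gain _ _ _ d'](prednK d0) gainS -subn1.
set g := gain _ _ _ _; set a := eps * rsum _ _ in cond *.
have frac : (m - 1) / m = 1 - / m by field; lra.
have im1 : / m < 1 by rewrite -Rinv_1; apply: Rinv_lt_contravar; rewrite /m; lra.
move=> low.
have key : 1 / m <= r ^ 2 * g + eps * ((m - 1) / m).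
  move: low cond; rewrite frac /Rmin; case_Rle; nra.
split; last by move: key => /=; lra.
by apply: Rmin_left; apply: Rle_trans key _; rewrite frac; nra.
Qed.

(** * Gluing the colorings around all precolored vertices *)

Lemma pairwise_far_walk (V : finType) (e : rel V) (W : {set V}) d n w w' :
  pairwise_far e W d -> w \in W -> w' \in W -> walk e n w w' -> (n < d)%N -> w = w'.
Proof.
move=> far wW w'W /walk_path[p [wp pw <-]] nd; apply: contrapT => ww'.
by have := far w w' wW w'W ww' p wp pw; rewrite leqNgt nd.
Qed.

Theorem mainTheorem6 (d : nat) (q : Q) (eps : R) :
  (0 < d)%nat -> Nat.modulo d 4 = 0%nat ->
  let d' := Nat.div d 4 in
  let k := Q2R q in
  0 < eps ->
  2 <= k -> k < 2 + 1 / (2 * INR d' - 1) ->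
  eps * rsum (d' - 1) (fun j => (k - 1) ^ (2 * j + 2))
    + eps * ((k - 1 + eps) / (k + eps)) >= 1 / (k + eps) ->
  forall (V : finType) (e : rel V), simple_graph e ->
  fractionally_colorable e k ->
  forall (W : {set V}), pairwise_far e W d ->
  forall phi : V -> R -> Prop, fractional_precoloring W (k + eps) phi ->
  precoloring_extends e W (k + eps) phi.
Proof.
move=> d_gt0 d_mod d' k eps0 k2 k_lt cond V e [esym _] kcol W far phi phiP.
have d4 : d = (4 * d')%N by rewrite [LHS](PeanoNat.Nat.div_mod_eq d 4) d_mod -plus_n_O multE.
have d'_gt0 : (0 < d')%N by move: d_gt0; rewrite d4 muln_gt0.
have d'_ge1 : 1 <= INR d' by rewrite -[1]/(INR 1); apply: le_INR; apply/leP.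
set m := k + eps in cond phiP *.
pose r := k - 1; have r1 : 1 <= r by rewrite /r; lra.
have mE : r + 1 + eps = m by rewrite /r /m; lra.
have m0 : 0 <= m by rewrite /m; lra.
pose g := level_gain m r eps d'.
have [g1 g2] : g 1%N = 1 / m /\ 1 / m <= r * g 2%N + eps * ((m - 1) / m).
  rewrite /g -mE; apply: level_gain1 => //.
  by move: cond; rewrite /= mE /r (_ : k - 1 + eps = m - 1) // /m; lra.
have k0 : 0 < k by lra.
have km : k < m by rewrite /m; lra.
have [C [c [S phiC]]] := mixed_system k0 km kcol phiP.
pose E := Ico 0 m `\` C.
have cE : color_set m E := color_setD (color_set_Ico m) (system_color_set S).
have EC : E `&` C = set0 by rewrite -subset0 => x [[_]].
have muE : mu E = eps.
  rewrite (mu_setD (color_set_Ico m) (system_color_set S) (system_color_set S).1).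
  by rewrite mu_Ico // (system_mu S) /m; lra.
have cphi w : w \in W -> color_set m (phi w) /\ mu (phi w) = 1.
  by move=> /phiP /unit_color_setP.
have muEphi w : w \in W -> mu (E `\` phi w) = eps * ((m - 1) / m).
  move=> wW; have [cw w1] := cphi w wW; have [wC _] := phiC w wW.
  have h1 := mu_split cw.2 (color_set_finite cE).
  have h2 := mu_split (system_color_set S).2 (color_set_finite cw).
  (* This set has measure 1 - k/m = eps/m. *)
  have eqE : E `&` phi w = phi w `\` C.
    by rewrite /E setIDAC setIDA (setIidr cw.1).
  move: h1 h2; rewrite eqE muE w1 wC => h1 h2.
  have -> : mu (E `\` phi w) = eps - 1 + 1 / m * k by lra.
  have mn0 : m <> 0 by rewrite /m => ?; lra.
  by rewrite (_ : k = m - eps); [field|rewrite /m; lra].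
have /choice[U UP] w : exists U, w \in W -> exchange c m k C (phi w) g U.
  have [wW|] := boolP (w \in W); last by exists (fun=> set0).
  have [wC wc] := phiC w wW.
  have [||||U UX] := @exchange_exists V e c m k C (phi w) g _ S (cphi w wW).1 wC wc.
  - by rewrite /m; lra.
  - by move=> i; have := level_gain_bounds d' i r1 eps0; rewrite mE => -[].
  - by move=> i; apply: level_gain_le => //; rewrite /m; lra.
  - by move=> i; have := level_gain_bounds d' i r1 eps0; rewrite mE => -[].
  by exists U.
have U_far w i : w \in W -> (2 * d' <= i)%N -> U w i = set0.
  by move=> wW di; apply: (exchange0 (UP w wW)); apply: level_gain_far.
pose D w v := capped_dist e (2 * d') w v.
have d2 : (0 < 2 * d')%N by rewrite muln_gt0.
have far_walk w w' n : w \in W -> w' \in W -> walk e n w w' ->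
    (n < 2 * d' + 2 * d')%N -> w = w'.
  move=> wW w'W ww' n_lt; apply: (pairwise_far_walk far wW w'W ww').
  by rewrite d4 (_ : 4 * d' = 2 * d' + 2 * d')%N // -mulnDl.
(* Two walks of length at most 2d' - 1 make one of length at most 4d' - 2; with an edge between
   them, as in [near_edge], at most 4d' - 1, still below [d]. *)
have near_unique w w' v : w \in W -> w' \in W ->
    (D w v < 2 * d')%N -> (D w' v < 2 * d')%N -> w = w'.
  move=> wW w'W wv w'v; apply: (far_walk w w' (D w v + D w' v)%N) => //.
    apply: walk_cat (walk_capped_dist wv) (walk_sym esym (walk_capped_dist w'v)).
  by rewrite -addnS leq_add // ltnW.
have near_edge w w' u v : w \in W -> w' \in W -> e u v ->
    (D w u < 2 * d')%N -> (D w' v < 2 * d')%N -> w = w'.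
  move=> wW w'W uv wu w'v; apply: (far_walk w w' (D w u + 1 + D w' v)%N) => //.
    apply: walk_cat (walk_cat (walk_capped_dist wu) (walk1 uv)) _.
    exact: walk_sym esym (walk_capped_dist w'v).
  by rewrite addn1 -addnS leq_add.
pose pal w v := palette E (phi w) (c v) (U w) (D w v).
(* Precolored vertices get [phi], other vertices of a ball of radius 2d' - 1 a set from their
   palette, and all remaining vertices keep [c]. *)
have /choice[f fP] v : exists fv, [/\ unit_color_set m fv,
    forall w, w \in W -> (D w v < 2 * d')%N -> fv `<=` pal w v,
    v \in W -> fv = phi v &
    (forall w, w \in W -> (2 * d' <= D w v)%N) -> fv = c v].
  have Dvv : D v v = 0%N.
    by apply/eqP; rewrite -leqn0; apply: capped_dist_walk => /=.
  have [[w [wW wv]]|none] := EM (exists w, w \in W /\ (D w v < 2 * d')%N).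
    have uniq w' : w' \in W -> (D w' v < 2 * d')%N -> w' = w.
      by move=> w'W w'v; apply: (near_unique w' w v).
    have notfar : ~ (forall w, w \in W -> (2 * d' <= D w v)%N).
      by move=> /(_ w wW); rewrite leqNgt wv.
    case Dwv : (D w v) => [|i].
      have wv' : w = v.
        by have := walk_capped_dist wv; rewrite -/(D w v) Dwv => /eqP.
      exists (phi v); split=> //; first by apply: phiP; rewrite -wv'.
      by move=> w' w'W w'v; rewrite /pal (uniq w') // Dwv wv'.
    have vW : v \notin W.
      apply/negP => vW; have := uniq v vW; rewrite Dvv => /(_ d2) vw.
      by move: Dwv; rewrite -vw Dvv.
    have slack : g i.+1 <= (k - 1) * g i.+2 + mu (spare E (phi w) i.+1).
      rewrite /spare; have := @level_gain_step r eps d' i.+1 r1 eps0.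
      rewrite -Dwv => /(_ wv); rewrite Dwv /= mE -/g.
      case: ifP => oi; last by rewrite mu0.
      case: eqVneq => [->|_]; last by rewrite muE.
      by rewrite muEphi // g1.
    have [A [cA A1 Asub]] := palette_coloring v m0 S (cphi w wW).1 (UP w wW) slack.
    exists A; split=> //; first by apply/unit_color_setP.
    - by move=> w' w'W w'v; rewrite /pal (uniq w') // Dwv.
    - by rewrite (negbTE vW).
  have allfar w : w \in W -> (2 * d' <= D w v)%N.
    by move=> wW; rewrite leqNgt; apply/negP => wv; apply: none; exists w.
  exists (c v); split=> //.
  - by apply/unit_color_setP; split; [exact: (system_color_setE S v)|exact: (system_muE S v)].
  - by move=> w wW wv; case: none; exists w.
  by move=> /allfar; rewrite Dvv leqNgt d2.
(* A neighbor just outside the ball of [w] lies in no other ball, so it keeps [c v]; this fits the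
   palette at level 2d', where nothing is given up. *)
have f_pal w u v : w \in W -> e u v -> (D w u < 2 * d')%N -> f v `<=` pal w v.
  move=> wW uv wu; have [_ f1 _ f3] := fP v.
  have [wv|wv] := ltnP (D w v) (2 * d')%N; first exact: f1.
  rewrite f3; last first.
    move=> w' w'W; rewrite leqNgt; apply/negP => w'v.
    by move: wv; rewrite leqNgt (near_edge w w' u v wW w'W uv wu w'v) w'v.
  rewrite /pal; case Dwv : (D w v) wv => [|i] wv; first by move: d2; rewrite ltnNge wv.
  by move=> x vx; left; rewrite U_far // setD0.
have step u v x w : w \in W -> e u v -> (D w u < 2 * d')%N -> (D w u <= D w v)%N ->
    f u x -> f v x -> False.
  move=> wW uv wu le ux vx; have [_ f1 _ _] := fP u.
  have up : (D w v <= (D w u).+1)%N by apply: capped_dist_edge.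
  move: le; rewrite leq_eqVlt => /orP[/eqP eqD|lt].
    have wv : (D w v < 2 * d')%N by rewrite -eqD.
    (* An edge inside a sphere is excluded: the level is at most 2d' - 1 and k - 2 < 1/(2d' - 1). *)
    have h : INR (D w u) * (k - 2) < 1.
      have le1 : INR (D w u) <= 2 * INR d' - 1.
        have := le_INR _ _ (elimT leP wu); rewrite S_INR mult_INR /=; lra.
      have : (2 * INR d' - 1) * (k - 2) < 1.
        have one : (2 * INR d' - 1) * (1 / (2 * INR d' - 1)) = 1 by field; lra.
        by rewrite -[X in _ < X]one; apply: Rmult_lt_compat_l; lra.
      have : INR (D w u) * (k - 2) <= (2 * INR d' - 1) * (k - 2).
        by apply: Rmult_le_compat_r; lra.
      lra.
    apply: (sphere_independent esym S h (walk_capped_dist wu) _ uv).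
    by rewrite eqD; apply: walk_capped_dist.
  have Dv : D w v = (D w u).+1 by apply/eqP; rewrite eqn_leq up lt.
  have := palette_disjoint (D w u) (UP w wW) g1 EC (system_sub S (v := u))
    (system_sub S (v := v)) (system_disjoint S uv).
  rewrite -subset0 => /(_ x); apply; split; first exact: (f1 w wW wu x ux).
  by have := f_pal w u v wW uv wu x vx; rewrite /pal Dv.
exists f; split; last by move=> w wW x; have [_ _ -> //] := fP w.
split=> [v|u v uv x ux vx]; first by have [] := fP v.
have vu : e v u by rewrite esym.
have [[w [wW wu]]|nu] := EM (exists w, w \in W /\ (D w u < 2 * d')%N).
  case: (leqP (D w u) (D w v)) => [le|/ltnW le]; first exact: (step u v x w).
  by apply: (step v u x w) => //; apply: leq_ltn_trans le wu.
have [[w [wW wv]]|nv] := EM (exists w, w \in W /\ (D w v < 2 * d')%N).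
  case: (leqP (D w v) (D w u)) => [le|/ltnW le]; first exact: (step v u x w).
  by case: nu; exists w; split=> //; apply: leq_ltn_trans le wv.
(* Neither end lies in a ball, so both keep their original disjoint classes. *)
have [_ _ _ fu] := fP u; have [_ _ _ fv] := fP v.
have := system_disjoint S uv; rewrite -subset0 => /(_ x); apply; split.
  rewrite -fu // => w wW; rewrite leqNgt; apply/negP => wu; apply: nu; by exists w.
rewrite -fv // => w wW; rewrite leqNgt; apply/negP => wv; apply: nv; by exists w.
Qed.
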